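(* Let $\overrightarrow{G}$ be a proper circular arc digraph and let $X_{\overrightarrow{G}}(\mathbf{x},t)$ be its chromatic quasisymmetric function. Then $X_{\overrightarrow{G}}(\mathbf{x},t)\in\Lambda_{\mathbb{Q}}[t]$, i.e. for each $j$ the coefficient of $t^j$ is a symmetric function in $x_1,x_2,\dots$.
   Context: All digraphs are finite and simple; $(u,v)\in E$ is an edge directed from $u$ to $v$. An oriented graph is a digraph with no bidirected edges. $\overrightarrow{K_{12}}$ is the digraph on three vertices $a,b,c$ with exactly the edges $a\to b$ and $a\to c$; $\overrightarrow{K_{21}}$ is the digraph on three vertices $a,b,c$ with exactly the edges $b\to a$ and $c\to a$. In this paper, a proper circular arc digraph means an oriented graph having no induced subdigraph isomorphic to $\overrightarrow{K_{12}}$ or $\overrightarrow{K_{21}}$. For a digraph $\overrightarrow{G}=(V,E)$, a proper coloring is a map $\kappa:V\to\mathbb{P}=\{1,2,3,\dots\}$ with $\kappa(u)\ne\kappa(v)$ whenever $u,v$ are adjacent, $\mathrm{asc}(\kappa)=|\{(u,v)\in E:\kappa(u)<\kappa(v)\}|$, and $$X_{\overrightarrow{G}}(\mathbf{x},t)=\sum_{\kappa}t^{\mathrm{asc}(\kappa)}\prod_{v\in V}x_{\kappa(v)},$$ summed over all proper colorings. $\Lambda_{\mathbb{Q}}$ is the $\mathbb{Q}$-algebra of symmetric functions in $x_1,x_2,\dots$. *)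

(* Defs.v *)
From HB Require Import structures.
From mathcomp Require Import all_boot all_order all_algebra finmap.
From mathcomp Require Import boolp classical_sets functions cardinality fsbigop.
From mathcomp Require Import monalg.

Set Implicit Arguments.
Unset Strict Implicit.
Unset Printing Implicit Defensive.

Import GRing.Theory.
Local Open Scope ring_scope.

Definition oriented (V : finType) (E : rel V) : Prop :=
  irreflexive E /\ (forall u v, E u v -> ~~ E v u).

Definition digraph_iso (V W : finType) (E : rel V) (F : rel W) : Prop :=
  exists2 f : V -> W, bijective f & forall u v, F (f u) (f v) = E u v.

Definition induced (V : finType) (E : rel V) (S : {set V}) :
    rel {v : V | v \in S} := fun u v => E (val u) (val v).

(* The vertices a, b, c are the elements 0, 1, 2 of 'I_3. *)
Definition K12 : rel 'I_3 := fun u v => (u == 0) && (v != 0).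
Definition K21 : rel 'I_3 := fun u v => (u != 0) && (v == 0).

Definition proper_circular_arc (V : finType) (E : rel V) : Prop :=
  [/\ oriented E,
      forall S : {set V}, ~ digraph_iso (induced E (S := S)) K12
    & forall S : {set V}, ~ digraph_iso (induced E (S := S)) K21].

Definition color : choiceType := {n : nat | (0 < n)%N}.

Definition proper_coloring (V : finType) (E : rel V) (k : {ffun V -> color}) : Prop :=
  forall u v, E u v || E v u -> k u != k v.

Definition asc (V : finType) (E : rel V) (k : {ffun V -> color}) : nat :=
  #|[set uv : V * V | E uv.1 uv.2 && (val (k uv.1) < val (k uv.2))%N]|.

(* Formal power series in x_1, x_2, ... over R, of possibly unbounded degree,
   given by their coefficients: f m is the coefficient of the monomial m. *)
Definition pseries (R : Type) := {cmonom color} -> R.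

Definition coloring_monom (V : finType) (k : {ffun V -> color}) :
    {cmonom color} := \big[mmul/mone]_(v : V) ucm (k v).

(* An element of Q[t][[x_1, x_2, ...]], where t is 'X: the coefficient of m is
   the sum over all proper colorings k of the coefficient of m in
   t^asc(k) * prod_v x_(k v).  Only finitely many terms are nonzero, see
   [chromatic_finite_support]. *)
Definition chromatic (V : finType) (E : rel V) : pseries {poly rat} := fun m =>
  \sum_(k \in [set k : {ffun V -> color} | proper_coloring E k]%classic)
     ('X^(asc E k) *+ (coloring_monom k == m) : {poly rat}).

Lemma coloring_monomE (V : finType) (k : {ffun V -> color}) (c : color) :
  coloring_monom k c = #|[set v | k v == c]|.
Proof.
pose ev (m : {cmonom color}) : nat := m c.
have evM : {morph ev : m1 m2 / mmul m1 m2 >-> (m1 + m2)%N}.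
  by move=> *; exact: cmM.
rewrite -[LHS]/(ev _) /coloring_monom (big_morph ev evM (cm1 c)).
rewrite -sum1_card [RHS]big_mkcond /=.
by apply: eq_bigr => v _; rewrite inE /ev cmU; case: eqP.
Qed.

Lemma chromatic_finite_support (V : finType) (E : rel V) (m : {cmonom color}) :
  finite_set [set k : {ffun V -> color} | proper_coloring E k /\
    'X^(asc E k) *+ (coloring_monom k == m) != 0 :> {poly rat}]%classic.
Proof.
pose F (g : {ffun V -> finsupp m}) : {ffun V -> color} := [ffun v => val (g v)].
apply: (@sub_finite_set _ _ (F @` setT)%classic); last first.
  exact/finite_image/finite_finset.
move=> k [_]; case: (_ =P m) => [km _|_]; last by rewrite mulr0n eqxx.
have kin v : k v \in finsupp m.
  by rewrite mem_finsupp -km coloring_monomE cards_eq0; apply/set0Pn;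
     exists v; rewrite inE.
by exists [ffun v => [` kin v]%fset] => //; apply/ffunP => v; rewrite !ffunE.
Qed.

(* Membership in the algebra of symmetric functions: bounded degree, and
   invariance under every permutation s of the variables; m' is the image of m
   under x_i |-> x_(s i) exactly when m' (s i) = m i for all i. *)
Definition symmetric_function (R : nmodType) (f : pseries R) : Prop :=
  (exists d : nat, forall m, f m != 0 -> (mdeg m <= d)%N) /\
  (forall (s : color -> color) (m m' : {cmonom color}), bijective s ->
     (forall i, m' (s i) = m i) -> f m' = f m).

Definition coef_t (R : nzSemiRingType) (F : pseries {poly R}) (j : nat) :
    pseries R := fun m => (F m)`_j.

(* The first conjunct makes F a polynomial in t with power series as
   coefficients, and not merely a power series over R[t]. *)
Definition symmetric_function_poly (R : nzSemiRingType)
    (F : pseries {poly R}) : Prop :=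
  (exists d : nat, forall j, (d <= j)%N -> forall m, coef_t F j m = 0) /\
  (forall j, symmetric_function (coef_t F j)).

(* Main.v *)
Require Import Defs.
From mathcomp Require Import all_boot all_order all_algebra finmap.
From mathcomp Require Import boolp classical_sets functions cardinality fsbigop.
From mathcomp Require Import monalg zify.

(* Symmetry reduces to exchanging two consecutive colors a and b = a + 1.  For
   a proper coloring k, let S be the set of vertices colored a or b.  Since S
   carries a proper 2-coloring and K12 and K21 are not induced, every vertex of
   S has at most one out-neighbor and one in-neighbor in S: the components of S
   are directed paths and directed cycles.  So S has an involution r reversing
   all its edges, and k |-> (a b) o k o r is an involution on the proper
   colorings.  It exchanges the numbers of a's and b's; it preserves asc because
   r and the exchange each reverse the ascents inside S, while the comparisons
   with the other colors do not change as a and b are consecutive.  Reversing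
   the paths avoids a case distinction on the parity of their lengths. *)

Set Implicit Arguments.
Unset Strict Implicit.
Unset Printing Implicit Defensive.

Import GRing.Theory.
Local Open Scope ring_scope.

(** * Edge-reversing involutions when in- and out-degrees are at most one *)

Section Reversal.
Variables (V : finType) (e : rel V).

(** A boolean predicate on finite functions, so that [pick] can select a reversal. One implication
    on edges suffices: applied to the images it gives the converse, as [r] is an involution. *)
Definition reversal (S : {set V}) (r : {ffun V -> V}) : bool :=
  [&& [forall v, r (r v) == v], [forall v, (v \notin S) ==> (r v == v)]
    & [forall u in S, forall v in S, e u v ==> e (r v) (r u)]].

Lemma reversalP (S : {set V}) (r : {ffun V -> V}) :
  reflect [/\ involutive r, forall v, v \notin S -> r v = v
            & {in S &, forall u v, e u v -> e (r v) (r u)}]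
          (reversal S r).
Proof.
apply: (iffP and3P) => -[rK rS re]; split.
- by move=> v; apply/eqP/(forallP rK).
- by move=> v vS; apply/eqP/(implyP (forallP rS v)).
- move=> u v uS vS; apply/implyP.
  by move/forall_inP: re => /(_ u uS)/forall_inP/(_ v vS).
- by apply/forallP => v; rewrite rK.
- by apply/forallP => v; apply/implyP => /rS ->.
- apply/forall_inP => u uS; apply/forall_inP => v vS; apply/implyP; exact: re.
Qed.

Lemma involutive_stable (S : {set V}) (r : V -> V) : involutive r ->
  (forall v, v \notin S -> r v = v) -> forall v, (r v \in S) = (v \in S).
Proof.
move=> rK rS v; apply/idP/idP; first by apply: contraLR => vS; rewrite rS.
by apply: contraLR => vS; rewrite -(rK v) (rS _ vS).
Qed.

Definition out_unique (S : {set V}) :=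
  forall u v w, u \in S -> v \in S -> w \in S -> e u v -> e u w -> v = w.
Definition in_unique (S : {set V}) :=
  forall u v w, u \in S -> v \in S -> w \in S -> e v u -> e w u -> v = w.

Lemma longest_path (S : {set V}) : S != finset.set0 ->
  exists p : seq V, [/\ (0 < size p)%N, uniq p, sorted e p, {subset p <= S}
    & forall q : seq V, uniq q -> sorted e q -> {subset q <= S} ->
        (size q <= size p)%N].
Proof.
case/set0Pn => x xS.
pose P n := [exists t : n.-tuple V, [&& uniq t, sorted e t & all (mem S) t]].
have PP (q : seq V) : uniq q -> sorted e q -> {subset q <= S} -> P (size q).
  move=> qu qs /allP qS; apply/existsP; exists (in_tuple q).
  by rewrite /= qu qs.
have P1 : P 1%N by apply: (PP [:: x]) => // y; rewrite inE => /eqP ->.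
have Pb n : P n -> (n <= #|V|)%N.
  case/existsP => t /and3P[tu _ _].
  by rewrite -(size_tuple t) -(card_uniqP tu) max_card.
case: (ex_maxnP (ex_intro P 1%N P1) Pb) => n /existsP[t /and3P[tu ts tS]] nmax.
exists t; rewrite size_tuple; split=> //; first exact: nmax.
  by move=> y /(allP tS).
by move=> q qu qs qS; apply/nmax/PP.
Qed.

(* The vertex set of a longest path is a whole connected component, on which
   the only edges are those of the path and possibly one closing it; the
   reversal of the path also reverses the closing edge. *)
Lemma exists_reversal (S : {set V}) :
  out_unique S -> in_unique S -> exists r, reversal S r.
Proof.
have [n] := ubnP #|S|; elim: n S => // n IH S leSn outS inS.
have [->|/longest_path[p [p0 pu ps pS pmax]]] := eqVneq S finset.set0.
  exists [ffun v => v]; apply/reversalP; split=> [v|v _|u v];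
    by rewrite ?inE ?ffunE.
pose S' := S :\: [set x in p].
have S'S v : v \in S' -> v \in S by rewrite inE => /andP[].
have [||| r' /reversalP[rK rS re]] := IH S'.
- apply: leq_trans (_ : (#|S| <= n)%N) => //.
  apply/proper_card/properP; split; first by apply/fintype.subsetP/S'S.
  case: {ps pmax} p p0 pu pS @S' S'S => // x p _ _ pS *; exists x.
    by apply: pS; rewrite inE eqxx.
  by rewrite !inE eqxx.
- by move=> u v w /S'S uS /S'S vS /S'S wS; exact: outS.
- by move=> u v w /S'S uS /S'S vS /S'S wS; exact: inS.
have [x0 _] : exists x, x \in p.
  by case: (p) p0 => // x q _; exists x; rewrite inE eqxx.
set k := size p in p0.
have ep i : (i.+1 < k)%N -> e (nth x0 p i) (nth x0 p i.+1).
  by move/(sortedP x0): ps; apply.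
have pnS i : (i < k)%N -> nth x0 p i \in S by move=> ik; apply/pS/mem_nth.
have pinj i j : (i < k)%N -> (j < k)%N -> nth x0 p i = nth x0 p j -> i = j.
  by move=> ik jk /eqP; rewrite nth_uniq // => /eqP.
(* Compare the edge with the path edge leaving [i], or, if [i] is the last index, with the path edge
   entering [j]. Only an edge from the last vertex to the first escapes both. *)
have edge_p i j : (i < k)%N -> (j < k)%N -> e (nth x0 p i) (nth x0 p j) ->
    j = i.+1 \/ (j = 0%N /\ i = k.-1).
  move=> ik jk eij; have [ik'|ik'] := ltnP i.+1 k.
    left; apply: pinj => //; apply: outS (ep _ ik'); eauto.
  case: j => [|j] in jk eij *; first by right; split=> //; lia.
  suff : i = j by lia.
  by apply: pinj (ltnW jk) _ => //; apply: inS (ep _ jk); eauto using ltnW.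
(* If [u] has a successor on the path, that successor is [v]; otherwise appending [v] gives a longer
   path. Dually, [in_p] prepends a vertex. *)
have out_p u v : u \in p -> v \in S -> e u v -> v \in p.
  move=> up vS euv; apply/negPn/negP => vp.
  have ik : (index u p < k)%N by rewrite index_mem.
  have [ik'|ik'] := ltnP (index u p).+1 k.
    have := ep _ ik'; rewrite nth_index // => eu.
    by rewrite (outS u v _ (pS _ up) vS (pnS _ ik') euv eu) mem_nth in vp.
  have iE : index u p = k.-1 by lia.
  have := pmax (rcons p v); rewrite size_rcons ltnn rcons_uniq vp => H.
  suff: false by []; apply: H => //; last first.
    by move=> y; rewrite mem_rcons inE => /predU1P[->|/pS].
  apply/(sortedP x0) => i; rewrite size_rcons -/k ltnS => ik1.
  rewrite !nth_rcons -/k ik1; move: ik1; rewrite leq_eqVlt => /predU1P[ik1|ik1].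
    by rewrite ik1 ltnn eqxx (_ : i = index u p) ?nth_index //; lia.
  by rewrite ik1; exact: ep.
have in_p u v : v \in p -> u \in S -> e u v -> u \in p.
  move=> vp uS euv; apply/negPn/negP => up.
  have ik : (index v p < k)%N by rewrite index_mem.
  case iE: (index v p) ik => [|i] ik; last first.
    have := ep _ ik; rewrite -iE nth_index // => eu.
    have uE := inS v u _ (pS _ vp) uS (pnS _ (ltnW ik)) euv eu.
    by rewrite uE mem_nth // ltnW in up.
  have := pmax (u :: p); rewrite /= ltnn up => H.
  suff: false by []; apply: H => //; last first.
    by move=> y; rewrite inE => /predU1P[->|/pS].
  apply/(pathP x0) => -[|j] /=; first by rewrite -iE nth_index.
  exact: ep.
have S'P v : v \in S -> v \notin p -> v \in S'.
  by move=> vS vp; rewrite !inE vp.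
pose h i := (k.-1 - i)%N.
have hk i : (h i < k)%N by rewrite -[k in (_ < k)%N](prednK p0) ltnS leq_subr.
have hK i : (i < k)%N -> h (h i) = i.
  by move=> ik; apply: subKn; rewrite -ltnS prednK.
have hS i : (i.+1 < k)%N -> (h i.+1).+1 = h i.
  by move=> ik; apply: subnSK; rewrite ltn_predRL.
have ink v : v \in p -> (index v p < k)%N by rewrite index_mem.
pose rp v := nth x0 p (h (index v p)).
have rp_p v : rp v \in p by apply/mem_nth/hk.
have rpK v : v \in p -> rp (rp v) = v.
  move=> vp; rewrite /rp index_uniq ?hk //.
  by rewrite hK ?nth_index ?ink.
have S'p v : v \in p -> v \notin S' by move=> vp; rewrite !inE vp.
have rN v : v \notin p -> r' v \notin p.
  move=> vp; apply: contra (vp) => rvp.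
  by rewrite -(rK v) (rS _ (S'p _ rvp)).
exists [ffun v => if v \in p then rp v else r' v]; apply/reversalP; split.
- move=> v; rewrite !ffunE; case: (boolP (v \in p)) => vp.
    by rewrite rp_p rpK.
  by rewrite (negbTE (rN _ vp)) rK.
- move=> v vS; rewrite ffunE ifN; last by apply: contra vS => /pS.
  by apply: rS; apply: contra vS => /S'S.
- move=> u v uS vS euv; rewrite !ffunE.
  case: (boolP (u \in p)) => up.
    have vp := out_p _ _ up vS euv; rewrite vp /rp.
    have [iu iv] := (ink _ up, ink _ vp).
    have := edge_p _ _ iu iv; rewrite !nth_index // => /(_ euv)[iE|[iv0 iu1]].
      by rewrite iE in iv *; rewrite -(hS _ iv); apply: ep; rewrite hS.
    (* The closing edge is sent to itself, since the two ends of the path are exchanged. *)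
    by rewrite iv0 iu1 /h subn0 subnn -iu1 -iv0 !nth_index.
  have vp : v \notin p by apply: contra up => vp; apply: in_p vp uS euv.
  by rewrite (negbTE vp); apply: re => //; apply: S'P.
Qed.
End Reversal.

(** * Local consequences of the forbidden induced subdigraphs *)

(** Otherwise [u], [v], [w] are distinct and induce a copy of [K12], with [u] sent to 0; orientation
    excludes the edges back to [u]. *)
Lemma K12_free_out (V : finType) (E : rel V) (u v w : V) :
  oriented E -> (forall S : {set V}, ~ digraph_iso (induced E (S := S)) K12) ->
  E u v -> E u w -> ~~ E v w -> ~~ E w v -> v = w.
Proof.
move=> [Eirr Easym] noK uv uw vw wv; apply/eqP/negPn/negP => vNw.
have uNv : u != v by apply: contraTneq uv => ->; rewrite Eirr.
have uNw : u != w by apply: contraTneq uw => ->; rewrite Eirr.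
have [vu wu] := (negbTE (Easym _ _ uv), negbTE (Easym _ _ uw)).
pose S := u |: [set v; w].
pose f (x : {x | x \in S}) : 'I_3 :=
  if val x == u then 0 else if val x == v then 1 else inord 2.
have S3 (x : {x | x \in S}) : [\/ val x = u, val x = v | val x = w].
  have := valP x; rewrite !inE => /or3P[] /eqP;
    by [constructor 1|constructor 2|constructor 3].
have [fu fv fw] : [/\ forall x, val x = u -> f x = 0,
    forall x, val x = v -> f x = 1 & forall x, val x = w -> f x = inord 2].
  by split=> x xE; rewrite /f xE ?eqxx // ?[v == u]eq_sym ?[w == u]eq_sym
    ?[w == v]eq_sym ?(negbTE uNv) ?(negbTE uNw) ?(negbTE vNw).
have i2 : val (inord 2 : 'I_3) = 2%N by rewrite /= inordK.
apply: (noK S); exists f.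
  apply: inj_card_bij => [x y fxy|]; last first.
    by rewrite card_ord card_sig -(@eq_card _ (mem S)) // !cardsU1 cards1 !inE
               negb_or uNv uNw vNw.
  apply: val_inj; move: fxy.
  by case: (S3 x) => xE; case: (S3 y) => yE;
    rewrite ?(fu _ xE) ?(fv _ xE) ?(fw _ xE) ?(fu _ yE) ?(fv _ yE) ?(fw _ yE)
      ?xE ?yE // => /(congr1 val); rewrite ?i2.
move=> x y; rewrite /induced /K12.
by case: (S3 x) => xE; case: (S3 y) => yE;
  rewrite ?(fu _ xE) ?(fv _ xE) ?(fw _ xE) ?(fu _ yE) ?(fv _ yE) ?(fw _ yE)
    ?xE ?yE ?Eirr ?uv ?uw ?vu ?wu ?(negbTE vw) ?(negbTE wv) -?val_eqE ?i2.
Qed.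

(** Reversing all edges turns [K21] into [K12]. *)
Lemma K21_free_in (V : finType) (E : rel V) (u v w : V) :
  oriented E -> (forall S : {set V}, ~ digraph_iso (induced E (S := S)) K21) ->
  E v u -> E w u -> ~~ E v w -> ~~ E w v -> v = w.
Proof.
move=> [Eirr Easym] noK vu wu vw wv.
apply: (@K12_free_out V (fun x y => E y x) u) => // [|S [f fbij fE]].
  by split=> // x y; exact: Easym.
apply: (noK S); exists f => // x y.
by have := fE y x; rewrite /K12 /K21 andbC.
Qed.

(** * The involution on colorings for two consecutive colors *)

Section SwapColors.
Variables (V : finType) (E : rel V).

Definition swap_color (a b c : color) : color :=
  if c == a then b else if c == b then a else c.

Lemma swap_colorK a b : involutive (swap_color a b).
Proof.
move=> c; rewrite /swap_color; have [->|ca] := eqVneq c a.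
  by rewrite eqxx; case: eqVneq.
have [->|cb] := eqVneq c b; first by rewrite eqxx.
by rewrite (negbTE ca) (negbTE cb).
Qed.

Definition color_class (a b : color) (k : {ffun V -> color}) : {set V} :=
  [set v | (k v == a) || (k v == b)].

(** The identity as default makes this an involution for every [S], so [reverse_coloring] is an
    involution on all colorings, proper or not. *)
Definition reverse (S : {set V}) : {ffun V -> V} :=
  odflt [ffun v => v] [pick r | reversal E S r].

Definition reverse_coloring (a b : color) (k : {ffun V -> color}) :
    {ffun V -> color} :=
  [ffun v => swap_color a b (k (reverse (color_class a b k) v))].

Lemma reverseK (S : {set V}) : involutive (reverse S).
Proof.
rewrite /reverse; case: pickP => [r /reversalP[]|_ v] //=.
by rewrite !ffunE.
Qed.

Lemma reverse_id (S : {set V}) v : v \notin S -> reverse S v = v.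
Proof.
rewrite /reverse; case: pickP => [r /reversalP[_ rS _]|_ _] /=; first exact: rS.
by rewrite ffunE.
Qed.

Variables a b : color.
Implicit Type k : {ffun V -> color}.
Local Notation sw := (swap_color a b).
Local Notation cl := (color_class a b).
Local Notation rc := (reverse_coloring a b).
Local Notation r k := (reverse (cl k)).

Lemma mem_reverse (S : {set V}) v : (reverse S v \in S) = (v \in S).
Proof. exact: (involutive_stable (@reverseK S) (@reverse_id S)). Qed.

Lemma reverse_coloring_out k v : v \notin cl k -> rc k v = k v.
Proof.
move=> vS; rewrite ffunE reverse_id //; move: vS.
by rewrite inE negb_or /swap_color => /andP[/negbTE -> /negbTE ->].
Qed.

Lemma swap_color_in c : ((sw c == a) || (sw c == b)) = ((c == a) || (c == b)).
Proof.
rewrite /swap_color; have [->|ca] := eqVneq c a; first by rewrite eqxx orbT.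
by have [cb|cb] := eqVneq c b; rewrite ?eqxx // (negbTE ca) (negbTE cb).
Qed.

(** Ensures that a second application of [reverse_coloring] uses the same reversal, hence undoes the
    first. *)
Lemma color_class_reverse k : cl (rc k) = cl k.
Proof.
apply/setP => v; rewrite inE ffunE swap_color_in.
by have := mem_reverse (cl k) v; rewrite [in X in X -> _]inE.
Qed.

Lemma reverse_coloringK : involutive rc.
Proof.
move=> k; apply/ffunP => v.
by rewrite ffunE color_class_reverse ffunE reverseK swap_colorK.
Qed.

(** The reversal merely permutes the vertices, so only the exchange of colors affects the
    exponents. *)
Lemma coloring_monom_reverse k c :
  coloring_monom (rc k) c = coloring_monom k (sw c).
Proof.
rewrite !coloring_monomE.
rewrite -(card_imset _ (inv_inj (@reverseK (cl k)))); apply: eq_card => v.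
apply/imsetP/idP; rewrite ?inE.
  by case=> w; rewrite inE ffunE => /eqP <- ->; rewrite swap_colorK.
move=> /eqP kv; exists (r k v); last by rewrite reverseK.
by rewrite inE ffunE reverseK kv swap_colorK.
Qed.

Hypothesis Epca : proper_circular_arc E.

Lemma reverse_edge k u v : proper_coloring E k ->
  u \in cl k -> v \in cl k -> E (r k v) (r k u) = E u v.
Proof.
case: Epca => Eo noK12 noK21 kp uS vS.
(* With only two colors available, two vertices colored differently from [x] share a color, so they
   are not adjacent. *)
have edge x y z : x \in cl k -> y \in cl k -> z \in cl k ->
    k y != k x -> k z != k x -> ~~ E y z /\ ~~ E z y.
  move=> xS yS zS yx zx; suff kyz : k y = k z.
    by split; apply/negP => Eyz; have := kp y z;
      rewrite Eyz ?orbT kyz eqxx => /(_ isT).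
  move: xS yS zS yx zx; rewrite !inE.
  by do 3![case/orP => /eqP ->]; rewrite ?eqxx.
have outS : out_unique E (cl k).
  move=> x y z xS yS zS xy xz.
  have [] := edge x y z xS yS zS; last exact: K12_free_out xy xz.
    by apply: kp; rewrite xy orbT.
  by apply: kp; rewrite xz orbT.
have inS : in_unique E (cl k).
  move=> x y z xS yS zS yx zx.
  have [] := edge x y z xS yS zS; last exact: K21_free_in yx zx.
    by apply: kp; rewrite yx.
  by apply: kp; rewrite zx.
have /reversalP[_ _ re] : reversal E (cl k) (r k).
  rewrite /reverse; case: pickP => //= noR.
  by have [r0] := exists_reversal outS inS; rewrite noR.
apply/idP/idP; last exact: re.
by move/re; rewrite !reverseK !mem_reverse; apply.
Qed.

Hypothesis ab : val b = (val a).+1.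

Lemma swap_color_lt c d : c \in pred2 a b -> d \in pred2 a b ->
  (val (sw c) < val (sw d))%N = (val d < val c)%N.
Proof.
have ba : (b == a) = false by rewrite -val_eqE ab gtn_eqF.
rewrite !inE /swap_color.
by do 2![case/orP => /eqP ->]; rewrite ?eqxx ?ba ?ltnn //
  ab ltnSn ltnNge leqnSn.
Qed.

(** No color lies strictly between [a] and [b]. *)
Lemma adjacent_color_lt c c' d :
  c \in pred2 a b -> c' \in pred2 a b -> d \notin pred2 a b ->
  (val c < val d)%N = (val c' < val d)%N /\
  (val d < val c)%N = (val d < val c')%N.
Proof.
rewrite !inE -!val_eqE ab.
move: (val c) (val c') (val d) (val a) => x x' y n; clear; lia.
Qed.

Lemma asc_reverse k : proper_coloring E k -> asc E (rc k) = asc E k.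
Proof.
move=> kp.
(* This involution on pairs matches the ascents of the two colorings. On pairs inside the class,
   reversing the edge and exchanging the colors compensate each other; other pairs stay fixed. *)
pose h (p : V * V) := if (p.1 \in cl k) && (p.2 \in cl k)
  then (r k p.2, r k p.1) else p.
have hK : involutive h.
  move=> [u v]; rewrite /h /=.
  have [uvS|/negbTE uvS] := boolP ((u \in cl k) && (v \in cl k)).
    by rewrite /= !mem_reverse !reverseK andbC uvS.
  by rewrite /= uvS.
have kS v : (k v \in pred2 a b) = (v \in cl k) by rewrite !inE.
have rkS v : (rc k v \in pred2 a b) = (v \in cl k).
  by rewrite -color_class_reverse !inE.
rewrite /asc -(card_imset _ (inv_inj hK)); apply: eq_card => -[u v].
have -> : ((u, v) \in [set h x | x in [set uv | E uv.1 uv.2 &&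
    (val (rc k uv.1) < val (rc k uv.2))%N]]) = E (h (u, v)).1 (h (u, v)).2 &&
    (val (rc k (h (u, v)).1) < val (rc k (h (u, v)).2))%N.
  apply/imsetP/idP => [[p]|H]; first by rewrite inE => pE ->; rewrite hK.
  by exists (h (u, v)); rewrite ?hK // inE.
rewrite inE /h [(u, v).1]/= [(u, v).2]/=.
case: ifP => [/andP[uS vS]|uvS].
  rewrite reverse_edge // ![rc k _]ffunE !reverseK.
  by rewrite swap_color_lt ?kS.
congr (_ && _); have [uS|uS] := boolP (u \in cl k); last first.
  rewrite (reverse_coloring_out uS).
  have [vS|vS] := boolP (v \in cl k); last by rewrite reverse_coloring_out.
  by have [] := @adjacent_color_lt (rc k v) (k v) (k u); rewrite ?rkS ?kS.
have vS : v \notin cl k by move: uvS; rewrite uS /= => ->.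
rewrite (reverse_coloring_out vS).
by have [] := @adjacent_color_lt (rc k u) (k u) (k v); rewrite ?rkS ?kS.
Qed.

Lemma reverse_coloring_proper k :
  proper_coloring E k -> proper_coloring E (rc k).
Proof.
move=> kp u v uv.
have [uS|uS] := boolP (u \in cl k); have [vS|vS] := boolP (v \in cl k).
- rewrite !ffunE (inj_eq (inv_inj (@swap_colorK a b))) eq_sym; apply: (kp).
  by rewrite (reverse_edge kp uS vS) (reverse_edge kp vS uS).
(* An edge with one end in the class keeps distinct colors, because exactly one of its ends is still
   colored [a] or [b]. *)
- apply: contraNneq vS => rcE; move: uS.
  by rewrite -color_class_reverse !inE rcE.
- apply: contraNneq uS => rcE; move: vS.
  by rewrite -color_class_reverse !inE rcE.
- by rewrite !reverse_coloring_out //; apply: kp.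
Qed.

Lemma chromatic_swap (m m' : {cmonom color}) :
  (forall c, m' c = m (sw c)) -> chromatic E m' = chromatic E m.
Proof.
move=> mm'; rewrite /chromatic.
rewrite (reindex_fsbig rc [set k | proper_coloring E k]%classic); last first.
  split=> [k /=|k k' _ _|k /= kp]; first exact: reverse_coloring_proper.
    exact: (inv_inj reverse_coloringK).
  by exists (rc k); [exact: reverse_coloring_proper | exact: reverse_coloringK].
apply: eq_fsbigr => k; rewrite inE /= => kp.
rewrite asc_reverse //; congr (_ *+ _); congr nat_of_bool.
apply/eqP/eqP => [km|km]; apply/eqP/cmP => c.
  by rewrite -(swap_colorK a b c) -coloring_monom_reverse km mm'.
by rewrite coloring_monom_reverse mm' km.
Qed.
End SwapColors.

(** * From adjacent transpositions to arbitrary permutations of the variables *)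

Lemma perm_eq_adjacent (T : eqType) (U : Type) (F : seq T -> U) :
  (forall p a b q, F (p ++ a :: b :: q) = F (p ++ b :: a :: q)) ->
  forall s t, perm_eq s t -> F s = F t.
Proof.
move=> Fswap s t st.
have move_front p a q q' : F (p ++ a :: q ++ q') = F (p ++ q ++ a :: q').
  elim: q p => //= b q IH p; rewrite Fswap.
  by have := IH (rcons p b); rewrite !cat_rcons.
(* An arbitrary common prefix [p] is what lets the induction set aside the head once it has been
   moved into place. *)
suff H p : F (p ++ s) = F (p ++ t) by have := H [::].
elim: s t st p => [|a s IH] t st p.
  by move: st; rewrite perm_sym => /perm_nilP ->.
have /path.splitPr at_ : a \in t by rewrite -(perm_mem st) inE eqxx.
case: at_ st => t1 t2; rewrite perm_sym -cat1s perm_catCA /= perm_cons perm_sym.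
by move/IH => /(_ (rcons p a)); rewrite !cat_rcons move_front.
Qed.

(** The bijection [s] need not preserve [cs], but it carries the support of [m] onto that of [m'].
    So the nonzero values agree up to order, and the numbers of zeros agree because both lists have
    the size of [cs]. *)
Lemma perm_eq_map_bij (T : choiceType) (s : T -> T) (m m' : T -> nat)
    (cs : seq T) :
  bijective s -> (forall i, m' (s i) = m i) -> uniq cs ->
  (forall i, m i != 0%N -> i \in cs) -> (forall i, m' i != 0%N -> i \in cs) ->
  perm_eq (map m cs) (map m' cs).
Proof.
move=> sbij ms csu mcs m'cs.
pose nz (x : nat) := x != 0%N.
have Hnz : perm_eq (filter nz (map m cs)) (filter nz (map m' cs)).
  rewrite !filter_map (eq_map (fun i => esym (ms i))) map_comp.
  apply/perm_map/uniq_perm; rewrite ?filter_uniq //.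
    by rewrite map_inj_uniq ?filter_uniq //; exact: bij_inj.
  case: sbij => s' sK s'K x; rewrite -[x]s'K mem_map; last exact: can_inj sK.
  rewrite !mem_filter /= /nz ms s'K.
  by case: (eqVneq (m _) 0%N) => //= mx; rewrite mcs ?m'cs // -(s'K x) ms.
rewrite -(perm_filterC nz) perm_sym -(perm_filterC nz) perm_sym.
have H0 l : filter (predC nz) l = nseq (count (predC nz) l) 0%N.
  by elim: l => //= -[|x] l ->.
have Hc : count (predC nz) (map m cs) = count (predC nz) (map m' cs).
  have := perm_size Hnz; rewrite !size_filter => Hn; apply/eqP.
  rewrite -(eqn_add2l (count nz (map m cs))) count_predC Hn count_predC.
  by rewrite !size_map.
by rewrite !H0 Hc perm_cat2r.
Qed.

Definition nth_color (i : nat) : color := exist _ i.+1 isT.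

Lemma nth_color_val (c : color) : nth_color (val c).-1 = c.
Proof. by apply: val_inj; case: c => -[]. Qed.

(** Colors start at 1 and positions at 0: entry [i] of [w] is the exponent of color [i + 1]. *)
Definition monom_of_seq (w : seq nat) : {cmonom color} :=
  [cmonom nth 0%N w (val c).-1
    | c in [fset nth_color i | i in iota 0 (size w)]]%M.

Lemma monom_of_seqE (w : seq nat) (c : color) :
  monom_of_seq w c = nth 0%N w (val c).-1.
Proof.
rewrite cmE fsfun_fun; case: ifPn => // cw.
rewrite nth_default // leqNgt; apply: contra cw => cw.
by rewrite -{1}(nth_color_val c) in_imfset // mem_iota.
Qed.

(** A bijection [s] may move infinitely many colors, so it need not be a product of transpositions.
    Both monomials have finite support, however, and their exponent lists up to a common bound are
    rearrangements of each other. *)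
Lemma symmetric_of_adjacent (U : Type) (f : {cmonom color} -> U) :
  (forall (a b : color) (m m' : {cmonom color}), val b = (val a).+1 ->
     (forall c, m' c = m (swap_color a b c)) -> f m' = f m) ->
  forall (s : color -> color) (m m' : {cmonom color}), bijective s ->
     (forall i, m' (s i) = m i) -> f m' = f m.
Proof.
move=> fswap s m m' sbij ms.
pose N := \max_(c <- (finsupp m `|` finsupp m')%fset) val c.
pose cs := map nth_color (iota 0 N).
have csP (c : color) : (c \in finsupp m `|` finsupp m')%fset -> c \in cs.
  move=> cmm; rewrite -(nth_color_val c) map_f // mem_iota /= add0n.
  have : (val c <= N)%N by apply: (leq_bigmax_seq c).
  by case: c {cmm} => -[].
have monE (m0 : {cmonom color}) : (forall c, m0 c != 0%N -> c \in cs) ->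
    m0 = monom_of_seq (map m0 cs).
  move=> m0cs; apply/eqP/cmP => c; rewrite monom_of_seqE -map_comp.
  have [cN|cN] := ltnP (val c).-1 N.
    by rewrite (nth_map 0%N) ?size_iota // nth_iota //= nth_color_val.
  rewrite nth_default ?size_map ?size_iota //; apply/eqP; apply: contraLR cN.
  move/m0cs => /mapP[i]; rewrite mem_iota /= add0n => iN -> /=.
  by rewrite -ltnNge.
have mcs c : m c != 0%N -> c \in cs.
  by rewrite -mem_finsupp => cm; apply: csP; rewrite inE cm.
have m'cs c : m' c != 0%N -> c \in cs.
  by rewrite -mem_finsupp => cm; apply: csP; rewrite inE cm orbT.
rewrite (monE m) // (monE m') //.
apply: (perm_eq_adjacent (F := f \o monom_of_seq)); last first.
  rewrite perm_sym; apply: perm_eq_map_bij sbij ms _ mcs m'cs.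
  by rewrite map_inj_uniq ?iota_uniq // => i j /(congr1 val) [].
move=> p x y q /=.
apply: (fswap (nth_color (size p)) (nth_color (size p).+1)) => // c.
rewrite !monom_of_seqE /swap_color -!val_eqE /=.
case: c => -[//|c] c0 /=; rewrite !eqSS !nth_cat.
have [cp|cp|cp] := ltngtP c (size p).
- by rewrite ltn_eqF /= ?cp // ltnS ltnW.
- case: eqP => [->|cp1] /=; first by rewrite ltnn subnn subSnn.
  rewrite ltnNge ltnW //=.
  have : (1 < c - size p)%N.
    by rewrite ltn_subRL addn1 ltn_neqAle cp andbT eq_sym; apply/eqP.
  by case: (c - size p)%N => [|[|]].
- by rewrite cp ltnNge leqnSn /= subnn subSnn.
Qed.

Theorem theorem9 (V : finType) (E : rel V) :
  proper_circular_arc E -> symmetric_function_poly (chromatic E).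
Proof.
move=> Epca; split.
  (* Ascents are pairs of vertices, which bounds the degree in t. *)
  exists #|{: V * V}|.+1 => j jd m.
  rewrite /coef_t /chromatic coef_sum big1 // => k _.
  rewrite coefMn coefXn; case: eqP => [jE|_]; last by rewrite mul0rn.
  by move: jd; rewrite jE ltnNge max_card.
move=> j; split=> [|s m m' sbij ms]; last first.
  rewrite /coef_t (symmetric_of_adjacent (f := chromatic E) _ sbij ms) //.
  by move=> a b m0 m0' ab; exact: chromatic_swap.
(* Every coloring monomial has degree exactly [#|V|]. *)
exists #|V| => m; apply: contraNT; rewrite -ltnNge => mV.
rewrite /coef_t /chromatic big1 ?coef0 // => k _.
case: eqP => [kE|_]; last by rewrite mulr0n.
move: mV; rewrite -kE /coloring_monom mdeg_prod.
by under eq_bigr do rewrite mdegU; rewrite sum1_card ltnn.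
Qed.
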